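(* Let $(b_n)_{n\ge1}$, $(c_n)_{n\ge 0}$ be real sequences with $c_n\neq0$ and $b_n\neq 0$ for every $n$, and let $(A_n)_{n\ge0}$, $(B_n)_{n\ge0}$ form a basis of the solution space of $$c_ny_{n+1}+c_{n-1}y_{n-1}-b_ny_n=0,\qquad n\ge 1.$$ Define, for $n\ge1$, $x_{n-1}=A_nA_{n-1}$, $y_{n-1}=B_nB_{n-1}$, $z_{n-1}=A_nB_{n-1}+A_{n-1}B_n$. Then $(x_n)$, $(y_n)$, $(z_n)$ form a basis of the solution space of the four-term recurrence relation $$c_{n+2}c_{n+1}^2b_n\,z_{n+2}+\big(b_nc_{n+1}^3-b_nb_{n+1}b_{n+2}c_{n+1}\big)z_{n+1}+\big(b_nb_{n+1}b_{n+2}c_n-b_{n+2}c_n^3\big)z_n-c_{n-1}c_n^2b_{n+2}\,z_{n-1}=0,\qquad n\ge1.$$ *)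

(* Defs.v *)
From mathcomp Require Import all_boot all_order all_algebra.
From mathcomp Require Import boolp classical_sets functions reals.

Set Implicit Arguments.
Unset Strict Implicit.
Unset Printing Implicit Defensive.

Import GRing.Theory.

Local Open Scope ring_scope.
Local Open Scope classical_set_scope.

(* The ambient space [nat -> R^o] is infinite dimensional, so [free] and
   [basis_of] from vector.v do not apply; these are their analogues for finite
   families in an arbitrary left module. *)
Definition lin_free (K : fieldType) (E : lmodType K) (s : seq E) : Prop :=
  forall a : 'I_(size s) -> K,
    \sum_(i < size s) a i *: s`_i = 0 -> forall i, a i = 0.

Definition lin_span (K : fieldType) (E : lmodType K) (s : seq E) : set E :=
  [set v | exists a : 'I_(size s) -> K, v = \sum_(i < size s) a i *: s`_i].

Definition is_basis (K : fieldType) (E : lmodType K) (V : set E) (s : seq E) :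
  Prop := lin_span s = V /\ lin_free s.

(* The coefficient [b 0] never occurs below. The regular module [R^o] (whose
   carrier is [R]) makes sequences an [lmodType R] under pointwise operations. *)
Definition three_term_sol (R : realType) (b c : nat -> R) : set (nat -> R^o) :=
  [set y | forall n : nat, (1 <= n)%N ->
     c n * y n.+1 + c n.-1 * y n.-1 - b n * y n = 0].

Definition four_term_sol (R : realType) (b c : nat -> R) : set (nat -> R^o) :=
  [set z | forall n : nat, (1 <= n)%N ->
     c n.+2 * c n.+1 ^+ 2 * b n * z n.+2
     + (b n * c n.+1 ^+ 3 - b n * b n.+1 * b n.+2 * c n.+1) * z n.+1
     + (b n * b n.+1 * b n.+2 * c n - b n.+2 * c n ^+ 3) * z n
     - c n.-1 * c n ^+ 2 * b n.+2 * z n.-1 = 0].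

(* Main.v *)
(** Let [q] be the symmetric bilinear form with matrix [[al, ga], [ga, be]] and
    [v n = (A n, B n)], so that [al x + be y + ga z] is [n |-> q (v n) (v n.+1)].
    With [P = c n.+1 * y n.+2] and [Q = c n * y n], the relation
    [P + Q = b n.+1 * y n.+1] turns the four-term recurrence for [y n * y n.+1]
    into [(P - Q) (P + Q) = b n.+1 * y n.+1 * (P - Q)]; polarization gives [z].
    A solution of the four-term recurrence is determined by its values at 0, 1, 2.
    Since [v 0, v 1] is a basis of the plane, [q] is determined, arbitrarily, by
    [q (v 0) (v 0)], [q (v 0) (v 1)], [q (v 1) (v 1)], and as [b 1, b 2, c 0, c 1]
    are nonzero these correspond bijectively to [q (v n) (v n.+1)], [n = 0, 1, 2]. *)

Require Import Defs.
From mathcomp Require Import all_boot all_order all_algebra.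
From mathcomp Require Import boolp classical_sets functions reals.
From mathcomp Require Import ring.

Import GRing.Theory.

Local Open Scope ring_scope.

Lemma lin_free2P (K : fieldType) (E : lmodType K) (u v : E) :
  lin_free [:: u; v] <->
  (forall a1 a2 : K, a1 *: u + a2 *: v = 0 -> a1 = 0 /\ a2 = 0).
Proof.
split=> [uv_free a1 a2 a_eq0|uv_free a].
  have := uv_free (fun i => [:: a1; a2]`_i).
  rewrite !big_ord_recl big_ord0 /= addr0 => /(_ a_eq0) a0.
  by split; [apply: (a0 ord0)|apply: (a0 (lift ord0 ord0))].
rewrite !big_ord_recl big_ord0 /= addr0 => /uv_free[a1 a2].
case=> [[|[|//]] lti]; [rewrite -[RHS]a1|rewrite -[RHS]a2];
  by congr (a _); apply: val_inj.
Qed.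

Lemma lin_free3P (K : fieldType) (E : lmodType K) (u v w : E) :
  lin_free [:: u; v; w] <->
  (forall a1 a2 a3 : K, a1 *: u + a2 *: v + a3 *: w = 0 ->
     [/\ a1 = 0, a2 = 0 & a3 = 0]).
Proof.
split=> [uvw_free a1 a2 a3 a_eq0|uvw_free a].
  have := uvw_free (fun i => [:: a1; a2; a3]`_i).
  rewrite !big_ord_recl big_ord0 /= addr0 addrA => /(_ a_eq0) a0.
  by split; [apply: (a0 ord0)|apply: (a0 (lift ord0 ord0))
            |apply: (a0 (lift ord0 (lift ord0 ord0)))].
rewrite !big_ord_recl big_ord0 /= addr0 addrA => /uvw_free[a1 a2 a3].
case=> [[|[|[|//]]] lti]; [rewrite -[RHS]a1|rewrite -[RHS]a2|rewrite -[RHS]a3];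
  by congr (a _); apply: val_inj.
Qed.

Lemma lin_span2P (K : fieldType) (E : lmodType K) (u v t : E) :
  lin_span [:: u; v] t <-> exists a1 a2 : K, t = a1 *: u + a2 *: v.
Proof.
split=> [[a ->]|[a1 [a2 ->]]].
  by rewrite !big_ord_recl big_ord0 /= addr0; do 2!eexists.
exists (fun i => [:: a1; a2]`_i).
by rewrite !big_ord_recl big_ord0 /= addr0.
Qed.

Lemma lin_span3P (K : fieldType) (E : lmodType K) (u v w t : E) :
  lin_span [:: u; v; w] t <->
  exists a1 a2 a3 : K, t = a1 *: u + a2 *: v + a3 *: w.
Proof.
split=> [[a ->]|[a1 [a2 [a3 ->]]]].
  by rewrite !big_ord_recl big_ord0 /= addr0 addrA; do 3!eexists.
exists (fun i => [:: a1; a2; a3]`_i).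
by rewrite !big_ord_recl big_ord0 /= addr0 addrA.
Qed.

Section Recurrences.
Context {R : realType} {b c : nat -> R}.
Hypothesis c_neq0 : forall n : nat, c n != 0.

Lemma three_term_solD (a1 a2 : R) (u v : nat -> R^o) :
  three_term_sol b c u -> three_term_sol b c v ->
  three_term_sol b c (a1 *: u + a2 *: v).
Proof.
move=> su sv n n_gt0; move: (su n n_gt0) (sv n n_gt0).
rewrite !fctE /GRing.scale /= => eu ev.
(* Each 0 stands for the left-hand side of one recurrence; substituting it back leaves a ring
   identity. *)
transitivity (a1 * 0 + a2 * 0 : R); last by rewrite !mulr0 addr0.
by rewrite -[in a1 * _]eu -[in a2 * _]ev; ring.
Qed.

Lemma four_term_solD (a1 a2 : R) (u v : nat -> R^o) :
  four_term_sol b c u -> four_term_sol b c v ->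
  four_term_sol b c (a1 *: u + a2 *: v).
Proof.
move=> su sv n n_gt0; move: (su n n_gt0) (sv n n_gt0).
rewrite !fctE /GRing.scale /= => eu ev.
transitivity (a1 * 0 + a2 * 0 : R); last by rewrite !mulr0 addr0.
by rewrite -[in a1 * _]eu -[in a2 * _]ev; ring.
Qed.

Lemma three_term_solS {y : nat -> R^o} (n : nat) : three_term_sol b c y ->
  y n.+2 = (b n.+1 * y n.+1 - c n * y n) / c n.+1.
Proof.
move=> /(_ n.+1 isT) /= e; apply: (mulfI (c_neq0 n.+1)).
rewrite [RHS]mulrC divfK //; apply/eqP; rewrite -subr_eq0 -{}[X in _ == X]e.
by apply/eqP; ring.
Qed.

Lemma three_term_sol_eq0 (y : nat -> R^o) :
  three_term_sol b c y -> y 0%N = 0 -> y 1%N = 0 -> y = 0.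
Proof.
move=> sy y0 y1; apply/funext => n.
suff [] : y n = 0 /\ y n.+1 = 0 by [].
elim: n => [//|n [yn yn1]]; split=> //.
by rewrite (three_term_solS n sy) yn yn1 !mulr0 subr0 mul0r.
Qed.

(** If it vanished, [B 0 *: A - A 0 *: B] and [B 1 *: A - A 1 *: B] would be solutions zero at 0 and
    1, hence zero. Freeness then kills all four initial values, so [A = 0], against freeness
    again. *)
Lemma casoratian_neq0 (A B : nat -> R^o) :
  three_term_sol b c A -> three_term_sol b c B -> lin_free [:: A; B] ->
  (A 0%N * B 1%N - A 1%N * B 0%N : R) != 0.
Proof.
move=> sA sB /lin_free2P AB_free; apply/eqP => D0.
have [B0 /oppr_inj] : B 0%N = 0 /\ - A 0%N = - 0.
  rewrite oppr0; apply: AB_free; apply: three_term_sol_eq0.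
  - exact: three_term_solD.
  - by rewrite !fctE /GRing.scale /=; ring.
  - by rewrite !fctE /GRing.scale /= -[RHS]oppr0 -D0; ring.
move=> A0.
have [B1 /oppr_inj] : B 1%N = 0 /\ - A 1%N = - 0.
  rewrite oppr0; apply: AB_free; apply: three_term_sol_eq0.
  - exact: three_term_solD.
  - by rewrite !fctE /GRing.scale /= -[RHS]D0; ring.
  - by rewrite !fctE /GRing.scale /=; ring.
move=> A1.
have [] := AB_free 1 0; last by move/eqP; rewrite oner_eq0.
by rewrite scale1r scale0r addr0; exact: three_term_sol_eq0.
Qed.

(** Eliminating the highest index first expresses everything through [u] and [v] at two consecutive
    indices, leaving a rational identity whose denominators are values of [c]. *)
Lemma four_term_sol_symprod (u v : nat -> R^o) :
  three_term_sol b c u -> three_term_sol b c v ->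
  four_term_sol b c (fun n => u n.+1 * v n + u n * v n.+1).
Proof.
move=> su sv [//|n] _ /=.
rewrite !(three_term_solS n.+2 su) !(three_term_solS n.+1 su).
rewrite !(three_term_solS n su) !(three_term_solS n.+2 sv).
rewrite !(three_term_solS n.+1 sv) !(three_term_solS n sv).
by field; rewrite !c_neq0.
Qed.

Lemma four_term_sol_sqr (u : nat -> R^o) :
  three_term_sol b c u -> four_term_sol b c (fun n => u n.+1 * u n).
Proof.
move=> su.
have suu := four_term_sol_symprod _ _ su su.
(* For [u = v] the symmetric product is twice [u n.+1 * u n], hence the factor one half. *)
have := four_term_solD (2^-1) 0 _ _ suu suu.
congr (four_term_sol b c _); apply/funext => n.
by rewrite !fctE /GRing.scale /=; field.
Qed.

Hypothesis b_neq0 : forall n : nat, (1 <= n)%N -> b n != 0.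

(** Three consecutive zeros propagate because the leading coefficient, a product of values of [c]
    and [b], is nonzero. *)
Lemma four_term_sol_eq0 (z : nat -> R^o) : four_term_sol b c z ->
  z 0%N = 0 -> z 1%N = 0 -> z 2%N = 0 -> z = 0.
Proof.
move=> sz z0 z1 z2; apply/funext => n.
suff [] : [/\ z n = 0, z n.+1 = 0 & z n.+2 = 0] by [].
elim: n => [//|n [zn zn1 zn2]]; split=> //.
have /= := sz n.+1 isT.
rewrite zn zn1 zn2 !mulr0 !addr0 subr0 => /eqP.
by rewrite !mulf_eq0 !(negPf (c_neq0 _)) (negPf (b_neq0 n.+1 isT)) => /eqP.
Qed.

End Recurrences.

Section SymmetricForm.
Context {K : fieldType}.
Implicit Types (al be ga : K) (u v : K * K).

Definition symform al be ga u v : K :=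
  al * (u.1 * v.1) + be * (u.2 * v.2) + ga * (v.1 * u.2 + u.1 * v.2).

Lemma symform_surj u v (q00 q01 q11 : K) : u.1 * v.2 - v.1 * u.2 != 0 ->
  exists al be ga : K,
    [/\ symform al be ga u u = q00, symform al be ga u v = q01
      & symform al be ga v v = q11].
Proof.
case: u v => u1 u2 [v1 v2] /= D_neq0; pose D := u1 * v2 - v1 * u2.
(* The entries of the form in the dual basis of [u, v]. *)
exists ((v2 ^+ 2 * q00 - 2 * u2 * v2 * q01 + u2 ^+ 2 * q11) / D ^+ 2).
exists ((v1 ^+ 2 * q00 - 2 * u1 * v1 * q01 + u1 ^+ 2 * q11) / D ^+ 2).
exists ((- v1 * v2 * q00 + (u1 * v2 + v1 * u2) * q01 - u1 * u2 * q11) / D ^+ 2).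
by rewrite /symform /D /=; split; field.
Qed.

(** The squared determinant times each entry is the combination of the three values that forms the
    numerator in [symform_surj]. *)
Lemma symform_eq0 al be ga u v : u.1 * v.2 - v.1 * u.2 != 0 ->
  symform al be ga u u = 0 -> symform al be ga u v = 0 ->
  symform al be ga v v = 0 -> [/\ al = 0, be = 0 & ga = 0].
Proof.
case: u v => u1 u2 [v1 v2]; rewrite /symform /= => D_neq0 q00 q01 q11.
have D2_neq0 : (u1 * v2 - v1 * u2) ^+ 2 != 0 by rewrite expf_neq0.
split; apply: (mulfI D2_neq0); rewrite mulr0.
- transitivity (v2 ^+ 2 * 0 - 2 * u2 * v2 * 0 + u2 ^+ 2 * 0 : K); last by ring.
  by rewrite -{1}q00 -{1}q01 -{1}q11; ring.
- transitivity (v1 ^+ 2 * 0 - 2 * u1 * v1 * 0 + u1 ^+ 2 * 0 : K); last by ring.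
  by rewrite -{1}q00 -{1}q01 -{1}q11; ring.
- transitivity (- v1 * v2 * 0 + (u1 * v2 + v1 * u2) * 0 - u1 * u2 * 0 : K);
    last by ring.
  by rewrite -{1}q00 -{1}q01 -{1}q11; ring.
Qed.

End SymmetricForm.

Theorem theorem3p2 (R : realType) (b c : nat -> R) (A B x y z : nat -> R^o)
    (hc : forall n : nat, c n != 0)
    (hb : forall n : nat, (1 <= n)%N -> b n != 0)
    (hAB : is_basis (three_term_sol b c) [:: A; B])
    (hx : forall n : nat, (1 <= n)%N -> x n.-1 = A n * A n.-1)
    (hy : forall n : nat, (1 <= n)%N -> y n.-1 = B n * B n.-1)
    (hz : forall n : nat, (1 <= n)%N -> z n.-1 = A n * B n.-1 + A n.-1 * B n) :
  is_basis (four_term_sol b c) [:: x; y; z].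
Proof.
case: hAB => AB_span AB_free.
have sA : three_term_sol b c A.
  by rewrite -AB_span lin_span2P; exists 1, 0; rewrite scale1r scale0r addr0.
have sB : three_term_sol b c B.
  by rewrite -AB_span lin_span2P; exists 0, 1; rewrite scale1r scale0r add0r.
have D_neq0 := casoratian_neq0 hc _ _ sA sB AB_free.
have {hx} xE : x = fun n => A n.+1 * A n by apply/funext => n; apply: (hx n.+1).
have {hy} yE : y = fun n => B n.+1 * B n by apply/funext => n; apply: (hy n.+1).
have {hz} zE : z = fun n => A n.+1 * B n + A n * B n.+1.
  by apply/funext => n; apply: (hz n.+1).
have sx : four_term_sol b c x by rewrite xE; apply: four_term_sol_sqr.
have sy : four_term_sol b c y by rewrite yE; apply: four_term_sol_sqr.
have sz : four_term_sol b c z by rewrite zE; apply: four_term_sol_symprod.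
have s_comb (al be ga : R) : four_term_sol b c (al *: x + be *: y + ga *: z).
  rewrite -[_ + be *: y]scale1r; apply: four_term_solD => //.
  exact: four_term_solD.
pose v n : R * R := (A n, B n).
have combE (al be ga : R) n :
    (al *: x + be *: y + ga *: z) n = symform al be ga (v n) (v n.+1).
  by rewrite xE yE zE !fctE /GRing.scale /symform /=; ring.
have b1 := hb 1%N isT; have b2 := hb 2%N isT.
(* Pair [v n.+1] with the vector relation [b n.+1 * v n.+1 = c n.+1 * v n.+2 + c n * v n]. *)
have recur (al be ga : R) n : b n.+1 * symform al be ga (v n.+1) (v n.+1) =
    c n.+1 * symform al be ga (v n.+1) (v n.+2)
    + c n * symform al be ga (v n) (v n.+1).
  rewrite /symform /= (three_term_solS hc _ sA) (three_term_solS hc _ sB).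
  by field.
(* Evaluate the form on both sides of [c 1 * v 2 = b 1 * v 1 - c 0 * v 0]. *)
have norm2 (al be ga : R) : c 1%N ^+ 2 * symform al be ga (v 2%N) (v 2%N) =
    b 1%N ^+ 2 * symform al be ga (v 1%N) (v 1%N)
    - 2 * b 1%N * c 0%N * symform al be ga (v 0%N) (v 1%N)
    + c 0%N ^+ 2 * symform al be ga (v 0%N) (v 0%N).
  rewrite /symform /= (three_term_solS hc _ sA) (three_term_solS hc _ sB).
  by field.
split.
  apply/seteqP; split=> [t /lin_span3P[al [be [ga ->]]]|t st]; first exact: s_comb.
  apply/lin_span3P.
  (* These values are forced: [recur] at 0 and 1 gives [q11] and [q22], and [norm2] solved for its
     last term gives [q00]. *)
  pose q11 : R := (c 1%N * t 1%N + c 0%N * t 0%N) / b 1%N.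
  pose q22 : R := (c 2%N * t 2%N + c 1%N * t 1%N) / b 2%N.
  pose q00 : R := (c 1%N ^+ 2 * q22 - b 1%N ^+ 2 * q11
                   + 2 * b 1%N * c 0%N * t 0%N) / c 0%N ^+ 2.
  have [al [be [ga [e00 e01 e11]]]] :=
    symform_surj (v 0%N) (v 1%N) q00 (t 0%N) q11 D_neq0.
  have e22 : symform al be ga (v 2%N) (v 2%N) = q22.
    apply: (mulfI (expf_neq0 2 (hc 1%N))); rewrite norm2 e00 e01 e11 /q00.
    by field.
  have e12 : symform al be ga (v 1%N) (v 2%N) = t 1%N.
    (* Completes the left side to the right side of [recur] at 0. *)
    apply: (mulfI (hc 1%N)); apply: (addIr (c 0%N * t 0%N)).
    by rewrite -{1}e01 -recur e11 /q11; field.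
  have e23 : symform al be ga (v 2%N) (v 3%N) = t 2%N.
    apply: (mulfI (hc 2%N)); apply: (addIr (c 1%N * t 1%N)).
    by rewrite -{1}e12 -recur e22 /q22; field.
  exists al, be, ga; set w := _ + ga *: z.
  (* The solution [w - t] vanishes at 0, 1, 2 by [e01], [e12], [e23], hence everywhere. *)
  have wt_eq0 n : symform al be ga (v n) (v n.+1) = t n -> (w - t) n = 0.
    by move=> e; rewrite -[LHS]/(w n - t n) /w combE e subrr.
  apply/eqP; rewrite eq_sym -subr_eq0; apply/eqP.
  apply: (four_term_sol_eq0 hc hb); try exact: wt_eq0.
  have -> : w - t = 1 *: w + (-1) *: t by rewrite scale1r scaleN1r.
  by apply: four_term_solD; [apply: s_comb|].
apply/lin_free3P => al be ga q0.
have q_eq0 n : symform al be ga (v n) (v n.+1) = 0 by rewrite -combE q0.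
(* [recur] reaches the diagonal values only from index 1 on; the one at 0 comes from [norm2]. *)
have qd_eq0 n : symform al be ga (v n.+1) (v n.+1) = 0.
  apply: (mulfI (hb n.+1 isT)).
  by rewrite recur !q_eq0 !mulr0 addr0.
apply: (symform_eq0 _ _ _ (v 0%N) (v 1%N)) => //.
apply: (mulfI (expf_neq0 2 (hc 0%N))).
by have := norm2 al be ga; rewrite !qd_eq0 q_eq0 !mulr0 subr0 add0r.
Qed.
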